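(* Let $S$ be the set of pairs $(\alpha,\beta)\in\mathbb{R}^2$ such that $\lfloor \alpha \lfloor \beta x\rfloor\rfloor \ge \lfloor \beta \lfloor \alpha x\rfloor\rfloor$ for all $x\in\mathbb{R}$. Let $\alpha<0$, $\beta<0$ and suppose $(\alpha,\beta)\in S$. Then for every integer $m\ge 1$: (i) $(m\alpha,\beta)\in S$; (ii) $\left(\frac1m\alpha,\frac1m\beta\right)\in S$.
   Context: $\lfloor x\rfloor$ denotes the floor function (largest integer $\le x$). *)

(* Defs.v *)
From mathcomp Require Import all_boot all_order all_algebra.
From mathcomp Require Import classical_sets reals.

Set Implicit Arguments.
Unset Strict Implicit.
Unset Printing Implicit Defensive.

Import Order.TTheory GRing.Theory Num.Theory.

Local Open Scope classical_set_scope.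
Local Open Scope ring_scope.

Definition floor_comm_set {R : realType} : set (R * R) :=
  [set p | forall x : R,
     Num.floor (p.1 * (Num.floor (p.2 * x))%:~R) >=
     Num.floor (p.2 * (Num.floor (p.1 * x))%:~R)].

(* Main.v *)
Require Import Defs.
From mathcomp Require Import all_boot all_order all_algebra.
From mathcomp Require Import classical_sets reals.

(** For negative [alpha] and [beta], the pair lies in the set exactly when, below
    every integer [n], the largest multiple of [beta] is at least the largest
    multiple of [alpha].  Replacing [alpha] by [m * alpha] leaves fewer multiples
    of [alpha], and dividing both parameters by [m] amounts to testing the
    criterion only at the integers [m * n]. *)

Import Order.TTheory GRing.Theory Num.Theory.

Local Open Scope ring_scope.

Lemma floor_comm_setP_neg (R : realType) (alpha beta : R) :
    alpha < 0 -> beta < 0 ->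
  floor_comm_set (alpha, beta) <->
  forall n k : int, k%:~R * alpha < n%:~R ->
    exists j : int, k%:~R * alpha <= j%:~R * beta < n%:~R.
Proof.
move=> alpha0 beta0; split=> [hS n k kan | hL x] /=.
  have beta_neq0 : beta != 0 by rewrite lt_eqF.
  (* At [x = k / beta] the inner floor of [beta * x] is exactly [k]; the other inner floor becomes
     the witness [j]. *)
  have := hS (k%:~R / beta); rewrite /= [beta * (_ / _)]mulrC divfK // intrKfloor => le_fl.
  exists (Num.floor (alpha * (k%:~R / beta))); apply/andP; split.
    rewrite -ler_ndivlMr //; apply: le_trans (floor_le _) _.
    by rewrite mulrA (mulrC alpha).
  rewrite mulrC -floor_lt_int; apply: le_lt_trans le_fl _.
  by rewrite floor_lt_int mulrC.
(* [n] is the least integer strictly above [alpha * k]. *)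
set k := Num.floor (beta * x); set n := Num.floor (alpha * k%:~R) + 1.
have [j /andP[kaj jn]] : exists j : int, k%:~R * alpha <= j%:~R * beta < n%:~R.
  by apply: hL; rewrite mulrC floorD1_gt.
rewrite -ltzD1 floor_lt_int; apply: le_lt_trans jn.
(* As [beta < 0], [j <= alpha * x] suffices; as [alpha < 0], [k <= beta * x] gives [alpha * beta * x
   <= k * alpha <= j * beta]. *)
rewrite mulrC ler_nM2r // ler_int floor_ge_int.
rewrite -(ler_nM2r beta0) -mulrA (mulrC x); apply: le_trans kaj.
by rewrite (mulrC alpha) ler_nM2r // floor_le.
Qed.

Theorem theorem1p3 (R : realType) (alpha beta : R)
    (halpha : alpha < 0) (hbeta : beta < 0) (hS : floor_comm_set (alpha, beta)) :
  forall m : int, 1 <= m ->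
    floor_comm_set (m%:~R * alpha, beta) /\
    floor_comm_set (1 / m%:~R * alpha, 1 / m%:~R * beta).
Proof.
move=> m m_ge1.
have m_gt0 : 0 < m%:~R :> R by rewrite ltr0z; apply: lt_le_trans m_ge1.
have invm_gt0 : 0 < 1 / m%:~R :> R by rewrite divr_gt0.
have hL := (floor_comm_setP_neg R alpha beta halpha hbeta).1 hS.
split; apply/floor_comm_setP_neg; rewrite ?pmulr_rlt0 // => n k.
  by rewrite mulrA -intrM; apply: hL.
have scale (i : int) (c : R) : i%:~R * (1 / m%:~R * c) = i%:~R * c / m%:~R.
  by rewrite mul1r mulrCA mulrC.
(* The bound for the original pair is [n * m]; the same [j] serves after division by [m]. *)
rewrite scale ltr_pdivrMr // -intrM => /hL[j jP]; exists j.
by rewrite !scale ler_pM2r ?invr_gt0 // ltr_pdivrMr // -intrM.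
Qed.
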